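(* Let $f(x,u)=xu^2$. Define $\gamma:[0,\infty)\to\mathbb{R}$ by $\gamma(t)=(t-2)^2/4$ if $t\leq2$ and $\gamma(t)=0$ if $t>2$, and define $$u(x,t)=\begin{cases}-1/\sqrt{x}&\text{if }x>\gamma(t),\\0&\text{otherwise.}\end{cases}$$ Then $u$ is an entropy solution, on $\mathbb{R}\times[0,\infty)$, of the Cauchy problem $u_t+f(x,u)_x=0$ with initial value $u_0(x)=u(x,0)$. The initial value $u_0$ is bounded, while $u(\cdot,t)$ is unbounded for every $t\geq2$.
   Context: Entropy solution: $u$ is an entropy solution of $u_t+f(x,u)_x=0$, $u(x,0)=u_0(x)$, with $u_0\in L^\infty(\mathbb{R})$, if for every $k\in\mathbb{R}$ and every $\varphi\in C_c^\infty(\mathbb{R}\times[0,\infty))$ with $\varphi\geq0$, $$\iint |u(x,t)-k|\varphi_t+\operatorname{sgn}(u(x,t)-k)\left[f(x,u(x,t))-f(x,k)\right]\varphi_x\,dx\,dt\ \geq\ \iint\operatorname{sgn}(u(x,t)-k)f_x(x,k)\varphi(x,t)\,dx\,dt-\int|u_0(x)-k|\varphi(x,0)\,dx,$$ where the double integrals are over $\mathbb{R}\times[0,\infty)$, $f_x$ is the partial derivative of $f$ in its first argument, and $\operatorname{sgn}(0)=0$. The function $u$ itself is not required to be bounded; it is only required that $u$ and $f(x,u)$ be locally integrable. *)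

(* Defs.v *)
From HB Require Import structures.
From mathcomp Require Import all_boot all_order all_algebra.
From mathcomp Require Import all_classical all_reals all_analysis.

Set Implicit Arguments.
Unset Strict Implicit.
Unset Printing Implicit Defensive.
Import Order.TTheory GRing.Theory Num.Theory.
Import numFieldNormedType.Exports.

Local Open Scope classical_set_scope.
Local Open Scope ring_scope.

Section EntropySolutions.
Context {R : realType}.

Local Notation mu := (@lebesgue_measure R).

Local Notation mu2 := (mu \x mu)%E.

Definition half_plane : set (R * R) := [set z | 0 <= z.2].

Definition dx (g : R -> R -> R) : R -> R -> R := fun x t => derive1 (g ^~ t) x.
Definition dt (g : R -> R -> R) : R -> R -> R := fun x t => derive1 (g x) t.

(* [Ck n g]: all iterated partial derivatives of [g] of order at most [n]
   exist and are jointly continuous. *)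
Fixpoint Ck (n : nat) (g : R -> R -> R) : Prop :=
  continuous (fun z : R * R => g z.1 z.2) /\
  if n is m.+1 then
    [/\ forall x t, derivable (g ^~ t) x 1,
        forall x t, derivable (g x) t 1,
        Ck m (dx g) & Ck m (dt g)]
  else True.

(* An element of C_c^oo(R x [0,oo)) is the restriction to the closed half
   plane of a function in C_c^oo(R^2), so it need not vanish at t = 0; [phi]
   is such an extension, and only its values for t >= 0 are used.  This is
   why nonnegativity is required there only. *)
Definition test_function (phi : R -> R -> R) : Prop :=
  [/\ forall n, Ck n phi,
      compact (closure [set z : R * R | phi z.1 z.2 != 0]) &
      forall x t, 0 <= t -> 0 <= phi x t].

Definition locally_integrable2 (g : R -> R -> R) : Prop :=
  forall K : set (R * R), compact K -> K `<=` half_plane ->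
    mu2.-integrable K (fun z => (g z.1 z.2)%:E).

(* [f] is meant to be differentiable in its first argument, with f(., k) and
   f_x(., k) locally integrable.  All the integrands are then integrable, by
   the local integrability of u and f(x, u) and since u0 is in L^oo, so that
   the real-valued integrals never take their default value. *)
Definition entropy_solution (f : R -> R -> R) (u0 : R -> R) (u : R -> R -> R) :
    Prop :=
  [/\ u0 \in Lfun mu +oo%E,
      locally_integrable2 u,
      locally_integrable2 (fun x t => f x (u x t)) &
      forall (k : R) (phi : R -> R -> R), test_function phi ->
        \int[mu2]_(z in half_plane)
          (`|u z.1 z.2 - k| * dt phi z.1 z.2 +
           Num.sg (u z.1 z.2 - k) * (f z.1 (u z.1 z.2) - f z.1 k)
             * dx phi z.1 z.2)
        >= \int[mu2]_(z in half_plane)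
             (Num.sg (u z.1 z.2 - k) * derive1 (f ^~ k) z.1 * phi z.1 z.2)
           - \int[mu]_x (`|u0 x - k| * phi x 0)].

Definition flux (x v : R) : R := x * v ^+ 2.

Definition gamma (t : R) : R := if t <= 2 then (t - 2) ^+ 2 / 4 else 0.

Definition usol (x t : R) : R := if gamma t < x then - 1 / Num.sqrt x else 0.

End EntropySolutions.

(* Main.v *)
Require Import Defs.
From mathcomp Require Import all_boot all_order all_algebra.
From mathcomp Require Import all_classical all_reals all_analysis.
From mathcomp Require Import measurable_realfun ess_sup_inf ring lra.

(** Left of the curve [x = gamma t] the function [u] is [0] and the flux
    [f(x, u)] is [0]; right of it [u] is [-1 / sqrt x] and the flux is [1].  On
    each side the entropy inequality is therefore an equality, and everything
    happens on the curve.

    Fix [k] and a test function [phi].  The term [|u - k| phi_t] is integrated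
    in [t] first: for fixed [x] the function [u(x, .)] jumps once, at the time
    [hit x] at which the curve passes through [x], so that the result is
    [- |u0 - k| phi(x, 0)] plus the contribution [trace k phi x] of the jump
    ([integral_dt_part]).  The flux and source terms are integrated in [x]
    first: on each side of the curve their difference is an exact derivative in
    [x], which leaves a multiple of [phi(gamma t, t)] ([integral_space]).  The
    substitution [x = gamma t] ([integral_trace]) carries the first contribution
    to the curve too.  With [a = k * sqrt (gamma t)], the two together are, for
    [t <= 2], the integral of
    [(|a| - |1 + a| + a |a| + |1 + a| (1 - a)) * phi(gamma t, t)], whose first
    factor is nonnegative ([jump_trace_ge0]).  This is the Rankine-Hugoniot
    relation together with the entropy condition along the shock.  For [t > 2]
    the discontinuity stays at [x = 0], where the flux jumps from [0] to [1]:
    the equation fails there in the sense of distributions, by a Dirac mass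
    which has the sign that the entropy inequality permits.  No constant [k]
    lies below the unbounded function [u] there, so no [k] gives the reverse
    inequality.

    All the integrands are measurable, vanish outside a box and are dominated by
    a multiple of [1 + 1 / sqrt x] there; this justifies the use of Fubini's
    theorem ([integrable_prod_weight]).  The same domination gives the local
    integrability of [u] and [f(x, u)].  For [t >= 2],
    [u(x, t) = -1 / sqrt x] for all [x > 0], so that [u(., t)] is essentially
    unbounded. *)

Set Implicit Arguments.
Unset Strict Implicit.
Unset Printing Implicit Defensive.
Import Order.TTheory GRing.Theory Num.Theory.
Import numFieldNormedType.Exports.
Local Open Scope classical_set_scope.
Local Open Scope ring_scope.

(** * Measurability in the plane *)

(** An open set is a countable union of boxes with rational corners, hence
    belongs to the product sigma-algebra. *)
Lemma open_measurable_prod (R : realType) (U : set (R * R)) :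
  open U -> measurable U.
Proof.
move=> oU.
(* The four rationals are the end points of the two sides of the box. *)
pose box (i : rat * rat * (rat * rat)) : set (R * R) :=
  `]ratr i.1.1, ratr i.1.2[%classic `*` `]ratr i.2.1, ratr i.2.2[%classic.
have -> : U = \bigcup_(i in [set i | box i `<=` U]) box i.
  apply/seteqP; split=> [[x y] Uxy|z [i /= iU]]; last exact: iU.
  have /nbhs_ballP[e /= e0 eU] : nbhs (x, y) U by exact: open_nbhs_nbhs.
  have [a ax] : exists a, ratr a \in `]x - e, x[.
    by apply: rat_in_itvoo; rewrite ltrBlDr ltrDl.
  have [b bx] : exists b, ratr b \in `]x, x + e[.
    by apply: rat_in_itvoo; rewrite ltrDl.
  have [c cy] : exists c, ratr c \in `]y - e, y[.
    by apply: rat_in_itvoo; rewrite ltrBlDr ltrDl.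
  have [d dy] : exists d, ratr d \in `]y, y + e[.
    by apply: rat_in_itvoo; rewrite ltrDl.
  move: ax bx cy dy; rewrite !in_itv/=.
  move=> /andP[ax ax'] /andP[bx bx'] /andP[cy cy'] /andP[dy dy'].
  exists ((a, b), (c, d)) => /=; last first.
    by split; rewrite /= in_itv/= ?ax' ?bx ?cy' ?dy.
  move=> [p q] [] /=; rewrite !in_itv/= => /andP[p1 p2] /andP[q1 q2].
  apply: eU; split; rewrite /ball/= ltr_distlC; apply/andP; split; lra.
rewrite bigcup_mkcond; apply: countable_bigcupT_measurable => [|i].
  exact: countableP.
by case: ifP => // _; apply: measurableX; exact: measurable_itv.
Qed.

Lemma closed_measurable_prod (R : realType) (C : set (R * R)) :
  closed C -> measurable C.
Proof.
move=> cC; rewrite -[C]setCK; apply: measurableC; apply: open_measurable_prod.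
exact: closed_openC.
Qed.

Lemma continuous_measurable_prod (R : realType) (f : R * R -> R) :
  continuous f -> measurable_fun setT f.
Proof.
move=> cf; apply: (measurability _ (RGenOpens.measurableE R)).
move=> _ [_ [a [b ->] <-]]; rewrite setTI.
apply: open_measurable_prod; apply: open_comp; last exact: interval_open.
by move=> z _; exact: cf.
Qed.

Lemma compact_box (R : realType) (K : set (R * R)) : compact K ->
  measurable K /\ exists2 B : R, 0 < B &
    forall z, K z -> `|z.1| <= B /\ `|z.2| <= B.
Proof.
move=> cK; split.
  by apply: closed_measurable_prod; exact: compact_closed.
have [M [_ MK]] := compact_bounded cK.
exists (Num.max M 0 + 1).
  by rewrite ltr_wpDl// le_max lexx orbT.
move=> z Kz.
have : `|z| <= Num.max M 0 + 1.
  by apply: MK => //; rewrite ltr_pwDr// le_max lexx.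
by rewrite [`|z|]/Num.norm/= ge_max => /andP[].
Qed.

(** * Integration on the line *)

Lemma itv_split (R : realType) (f : R -> R) (a c b : R) :
  a <= c -> c <= b -> measurable_fun setT f ->
  (\int[lebesgue_measure]_(x in `[a, b]) (f x)%:E =
   \int[lebesgue_measure]_(x in `[a, c]) (f x)%:E +
   \int[lebesgue_measure]_(x in `[c, b]) (f x)%:E)%E.
Proof.
move=> ac cb mf.
have mfE (D : set R) : measurable_fun D (fun x => (f x)%:E).
  by apply/measurable_EFinP; apply: measurable_funTS.
rewrite -(@integral_itv_obnd_cbnd _ c); last exact: mfE.
rewrite (@itv_bndbnd_setU _ _ (BLeft a) (BRight c) (BRight b)) ?bnd_simp//.
rewrite integral_setU_EFin//; first exact: measurable_funS mf.
by apply/disj_set2P; rewrite -subset0 => x [] /=; rewrite !in_itv/=; lra.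
Qed.

(** The fundamental theorem of calculus for an integrand known only inside the
    interval. *)
Lemma integral_antiderivative (R : realType) (f F : R -> R) (a b : R) :
  a <= b -> measurable_fun setT f ->
  (forall x, derivable F x 1) -> continuous (derive1 F) ->
  {in `]a, b[, f =1 derive1 F} ->
  (\int[lebesgue_measure]_(x in `[a, b]) (f x)%:E = (F b - F a)%:E)%E.
Proof.
move=> ab mf dF cF fF.
have [ab'|] := ltP a b; last first.
  move=> ba; have -> : b = a by apply/le_anti/andP.
  by rewrite set_itv1 integral_set1 subrr.
have cF0 : continuous F.
  by move=> x; apply: differentiable_continuous; exact/derivable1_diffP.
rewrite integral_itv_bndoo; last first.
  by apply/measurable_EFinP; apply: measurable_funTS.
under eq_integral => x xab do rewrite fF ?(set_mem xab)//.
rewrite -(@integral_itv_bndoo _ _ _ _ true false); last first.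
  apply/measurable_EFinP; apply: measurable_funTS.
  exact: continuous_measurable_fun.
rewrite (@continuous_FTC2 _ _ F _ _ ab').
- by [].
- exact: continuous_subspaceT.
- split; first by move=> x _.
  + by apply: cvg_at_right_filter; exact: cF0.
  + by apply: cvg_at_left_filter; exact: cF0.
- by move=> x _.
Qed.

Lemma measurable_invsqrt (R : realType) :
  measurable_fun setT (fun x : R => (Num.sqrt x)^-1).
Proof.
have -> : (fun x : R => (Num.sqrt x)^-1) =
    (fun x => if 0 < x then x `^ (- 2^-1) else 0).
  apply/funext => x; case: ltP => x0; last by rewrite ler0_sqrtr ?invr0.
  by rewrite powRN powR12_sqrt// ltW.
apply: measurable_fun_ifT; [|exact: measurable_powR|exact: measurable_cst].
by apply: measurable_fun_ltr; [exact: measurable_cst|exact: measurable_id].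
Qed.

(** By monotone convergence on the intervals from [1 / (n + 1)] to [B], where
    [2 * sqrt x] is a primitive. *)
Lemma integrable_invsqrt (R : realType) (B : R) :
  (@lebesgue_measure R).-integrable `]0, B] (fun x => (Num.sqrt x)^-1%:E).
Proof.
have msqrtE (D : set R) : measurable_fun D (fun x => ((Num.sqrt x)^-1)%:E).
  by apply/measurable_EFinP; apply: measurable_funTS; exact: measurable_invsqrt.
apply/integrableP; split.
  exact: msqrtE.
under eq_integral do rewrite gee0_abs ?lee_fin ?invr_ge0 ?sqrtr_ge0//.
pose A (n : nat) := `[n.+1%:R^-1 : R, B]%classic.
have AE : `]0, B]%classic = \bigcup_n A n.
  apply/seteqP; split=> [x|x [n _]]; rewrite /A/= !in_itv/= => /andP[x0 xB].
    exists (Num.truncn x^-1) => //=; rewrite in_itv/= xB andbT.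
    rewrite invf_ple ?posrE//.
    exact/ltW/archimedean.Num.Theory.truncnS_gt.
  by rewrite xB andbT (lt_le_trans _ x0)// invr_gt0 ltr0n.
have ndA : nondecreasing_seq A.
  move=> m n mn; rewrite subsetEset => x.
  rewrite /A/= !in_itv/= => /andP[mx ->].
  by rewrite andbT (le_trans _ mx)// lef_pV2 ?posrE ?ltr0n// ler_nat ltnS.
rewrite AE.
have cv : (\int[lebesgue_measure]_(x in A n) ((Num.sqrt x)^-1)%:E @[n --> \oo]
    --> \int[lebesgue_measure]_(x in \bigcup_n A n) ((Num.sqrt x)^-1)%:E)%E.
  apply: ge0_nondecreasing_set_cvg_integral => //.
  - by move=> n; exact: measurable_itv.
  - by move=> n; exact: msqrtE.
rewrite -(cvg_lim (@ereal_hausdorff R) cv).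
apply: (@le_lt_trans _ _ (2 * Num.sqrt B)%:E); last exact: ltry.
apply: lime_le; first by apply/cvg_ex; eexists; exact: cv.
apply: nearW => n; rewrite /A.
have [nB|Bn|<-] := ltgtP n.+1%:R^-1 B; last 2 first.
- rewrite set_itv_ge ?integral_set0 ?lee_fin ?mulr_ge0 ?sqrtr_ge0//.
  by rewrite bnd_simp -ltNge.
- by rewrite set_itv1 integral_set1 lee_fin mulr_ge0// sqrtr_ge0.
have n0 : 0 < n.+1%:R^-1 :> R by rewrite invr_gt0 ltr0n.
have dF (x : R) : n.+1%:R^-1 <= x ->
    is_derive x 1 (fun y : R => 2 * Num.sqrt y) (Num.sqrt x)^-1.
  move=> nx; have x0 : 0 < x by exact: lt_le_trans nx.
  have ds := is_derive1_sqrt x0.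
  apply: is_derive_eq; rewrite /GRing.scale/= invfM.
  by rewrite mulrA divff ?mul1r// pnatr_eq0.
have cF : {within `[n.+1%:R^-1, B], continuous (fun x : R => 2 * Num.sqrt x)}.
  apply: continuous_subspaceT => x; apply: cvgM; first exact: cvg_cst.
  exact: sqrt_continuous.
rewrite (@continuous_FTC2 _ _ (fun x : R => 2 * Num.sqrt x) _ _ nB).
- by rewrite lee_fin gerBl mulr_ge0// sqrtr_ge0.
- apply: continuous_in_subspaceT => x; rewrite inE/= in_itv/= => /andP[nx _].
  apply: cvgV; last exact: sqrt_continuous.
  by rewrite gt_eqF// sqrtr_gt0 (lt_le_trans _ nx).
- split.
  + move=> x; rewrite in_itv/= => /andP[nx _].
    by have /@ex_derive := dF _ (ltW nx).
  + apply: cvg_at_right_filter; apply: cvgM; first exact: cvg_cst.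
    exact: sqrt_continuous.
  + apply: cvg_at_left_filter; apply: cvgM; first exact: cvg_cst.
    exact: sqrt_continuous.
- move=> x; rewrite in_itv/= => /andP[nx _].
  by rewrite derive1E; have /@derive_val := dF _ (ltW nx).
Qed.

(** * Integrability in the plane and Fubini's theorem *)

(** The dominating function: [1 + 1 / sqrt x] for [|x| <= B].  It is [1] for
    [- B <= x <= 0], since [Num.sqrt x = 0] and [0^-1 = 0]. *)
Definition weight (R : realType) (B x : R) : R :=
  if `|x| <= B then 1 + (Num.sqrt x)^-1 else 0.

Lemma integrable_weight (R : realType) (B : R) :
  (@lebesgue_measure R).-integrable setT (EFin \o weight B).
Proof.
have -> : EFin \o weight B = (fun x => (1 + (Num.sqrt x)^-1)%:E) \_ `[- B, B].
  apply/funext => x; rewrite patchE /= /weight ler_norml mem_setE in_itv/=.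
  by case: ifP.
apply: (integrable_mkcond _ _).1 => //.
have i1 : (@lebesgue_measure R).-integrable `[- B, B] (EFin \o cst 1).
  apply: measurable_bounded_integrable => //=.
  - by rewrite lebesgue_measure_itv/=; case: ifP => _; rewrite ltry.
  - by exists 1; split=> // M M1 x _; rewrite normr1 ltW.
have i2 : (@lebesgue_measure R).-integrable `[- B, B]
    (fun x => ((Num.sqrt x)^-1)%:E).
  apply: (integrable_mkcond _ _).2 => //.
  have -> : (fun x => ((Num.sqrt x)^-1)%:E) \_ `[- B, B] =
      (fun x => ((Num.sqrt x)^-1)%:E) \_ `]0, B] :> (R -> \bar R).
    apply/funext => x; rewrite !patchE.
    have [x0|x0] := leP x 0; first by rewrite ler0_sqrtr// invr0 !if_same.
    congr (if _ then _ else _); apply/idP/idP; rewrite !inE/= !in_itv/= ?x0 //=.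
      by case/andP.
    by move=> xB; rewrite xB andbT; lra.
  apply: (integrable_mkcond _ _).1 => //; exact: integrable_invsqrt.
exact: integrableD i1 i2.
Qed.

Lemma integrable_prod_weight (R : realType) (B C : R) (F : R * R -> R) :
  0 <= C -> measurable_fun setT F ->
  (forall x t, B < `|x| \/ B < `|t| -> F (x, t) = 0) ->
  (forall x t, `|x| <= B -> `|t| <= B ->
    `|F (x, t)| <= C * (1 + (Num.sqrt x)^-1)) ->
  (@lebesgue_measure R \x @lebesgue_measure R)%E.-integrable setT (EFin \o F).
Proof.
move=> C0 mF F0 FC.
have mw : measurable_fun setT (weight B).
  by apply/measurable_EFinP; exact: (measurable_int _ (integrable_weight B)).
have w0 x : 0 <= weight B x.
  by rewrite /weight; case: ifP => // _; rewrite addr_ge0// invr_ge0 sqrtr_ge0.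
pose G (z : R * R) := C * weight B z.1 * \1_(`[- B, B]%classic) z.2.
have mG : measurable_fun setT G.
  apply: measurable_funM; first apply: measurable_funM.
  - exact: measurable_cst.
  - exact: measurableT_comp mw _.
  - by apply: measurableT_comp; [exact: measurable_indic|exact: measurable_snd].
have G0 z : 0 <= G z by rewrite /G !mulr_ge0// indicE ler0n.
have iG : (@lebesgue_measure R \x @lebesgue_measure R)%E.-integrable setT
    (EFin \o G).
  apply/integrable12ltyP; first exact/measurable_EFinP.
  (* The measure of the interval of half-length [B]. *)
  pose m := fine (lebesgue_measure `[- B, B] : \bar R).
  have inner x : (\int[lebesgue_measure]_t `|(EFin \o G) (x, t)| =
      (C * weight B x * m)%:E)%E.
    under eq_integral => t _ do rewrite /= ger0_norm// /G/= EFinM.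
    rewrite ge0_integralZl//; last 2 first.
    - by apply/measurable_EFinP; exact: measurable_indic.
    - by rewrite lee_fin mulr_ge0.
    rewrite integral_indic// setIT [RHS]EFinM /m fineK//.
    by rewrite lebesgue_measure_itv/=; case: ifP.
  under eq_integral do rewrite inner.
  have : (@lebesgue_measure R).-integrable setT
      (fun x => (C * weight B x * m)%:E).
    rewrite (_ : (fun x => _) = (fun x => C%:E * (EFin \o weight B) x) \*
       cst (m)%:E)%E; last first.
      by apply/funext => x /=.
    apply: integrableZr => //; apply: integrableZl => //.
    exact: integrable_weight.
  exact: integrable_lty.
apply: (le_integrable measurableT _ _ iG).
- exact/measurable_EFinP.
- move=> [x t] _ /=; rewrite lee_fin (ger0_norm (G0 _)) /G /= indicE mem_setE.
  rewrite in_itv/= -ler_norml /weight.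
  case: (leP `|x| B) => xB; last by rewrite F0 ?normr0 ?mulr0 ?mul0r//; left.
  case: (leP `|t| B) => tB; last by rewrite F0 ?normr0 ?mulr0//; right.
  by rewrite mulr1 FC.
Qed.

(** Fubini's theorem for real integrals, when all the inner integrals are known
    to be finite. *)
Lemma fubini_x (R : realType) (F : R * R -> R) (I : R -> R) :
  (@lebesgue_measure R \x @lebesgue_measure R)%E.-integrable setT (EFin \o F) ->
  (forall x, \int[lebesgue_measure]_t (F (x, t))%:E = (I x)%:E)%E ->
  (@lebesgue_measure R).-integrable setT (EFin \o I) /\
  \int[(@lebesgue_measure R \x @lebesgue_measure R)%E]_z F z =
  \int[lebesgue_measure]_x I x.
Proof.
move=> iF FI; have := integrable_fubini_F iF; rewrite /fubini_F => iI.
split; first by apply: eq_integrable iI => // x _; exact: FI.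
rewrite /Rintegral -(integral12_prod_meas1 iF); congr fine.
by apply: eq_integral => x _; exact: FI.
Qed.

Lemma fubini_t (R : realType) (F : R * R -> R) (I : R -> R) :
  (@lebesgue_measure R \x @lebesgue_measure R)%E.-integrable setT (EFin \o F) ->
  (forall t, \int[lebesgue_measure]_x (F (x, t))%:E = (I t)%:E)%E ->
  (@lebesgue_measure R).-integrable setT (EFin \o I) /\
  \int[(@lebesgue_measure R \x @lebesgue_measure R)%E]_z F z =
  \int[lebesgue_measure]_t I t.
Proof.
move=> iF FI; have mF := measurable_int _ iF.
have FIE : fubini_G lebesgue_measure (EFin \o F) = EFin \o I.
  by apply/funext => t; exact: FI.
split; last first.
  rewrite /Rintegral -(integral21_prod_meas1 iF); congr fine.
  by apply: eq_integral => t _; exact: FI.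
apply/integrableP; split; first by rewrite -FIE; exact: measurable_fubini_G iF.
apply: le_lt_trans ((integrable21ltyP _ _ mF).1 iF).
have mFa : measurable_fun setT (abse \o (EFin \o F)).
  exact: measurableT_comp.
apply: ge0_le_integral => //.
- by rewrite -FIE; apply: measurableT_comp => //; exact: measurable_fubini_G iF.
- apply: (@measurable_fun_fubini_tonelli_G _ _ _ _ _ lebesgue_measure _ mFa).
  by move=> z; exact: abse_ge0.
- move=> t _; rewrite -[in leLHS]FIE; apply: le_abse_integral => //.
  exact: measurable_fun_pair1 mF.
Qed.

(** * The function u and its integrability *)

Lemma gamma_ge0 (R : realType) (t : R) : 0 <= gamma t.
Proof.
by rewrite /gamma; case: ifP => // _; rewrite divr_ge0 ?sqr_ge0// ler0n.
Qed.

Lemma measurable_gamma (R : realType) : measurable_fun setT (@gamma R).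
Proof.
apply: measurable_fun_ifT => //; first exact: measurable_fun_ler.
apply: measurable_funM => //; apply: measurable_funX.
exact: measurable_funB.
Qed.

Lemma measurable_usol (R : realType) :
  measurable_fun setT (fun z : R * R => usol z.1 z.2).
Proof.
apply: measurable_fun_ifT => //.
- apply: measurable_fun_ltr => //.
  exact: (measurableT_comp (@measurable_gamma R) measurable_snd).
- apply: measurable_funM => //.
  have : measurable_fun setT
      ((fun x : R => (Num.sqrt x)^-1) \o (fst : R * R -> R)).
    by apply: measurableT_comp => //; exact: measurable_invsqrt.
  by [].
Qed.

Lemma usol_le (R : realType) (x t : R) : `|usol x t| <= (Num.sqrt x)^-1.
Proof.
rewrite /usol; case: ifP => _; last by rewrite normr0 invr_ge0 sqrtr_ge0.
by rewrite mulN1r normrN ger0_norm// invr_ge0 sqrtr_ge0.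
Qed.

Lemma flux_usol (R : realType) (x t : R) :
  flux x (usol x t) = if gamma t < x then 1 else 0.
Proof.
rewrite /flux /usol; case: ifP => [gx|_]; last by rewrite expr0n mulr0.
have x0 : 0 < x by exact: le_lt_trans (gamma_ge0 t) gx.
by rewrite mulN1r sqrrN exprVn sqr_sqrtr ?ltW// divff// gt_eqF.
Qed.

Lemma locally_integrable2_weight (R : realType) (g : R -> R -> R) :
  measurable_fun setT (fun z : R * R => g z.1 z.2) ->
  (forall x t, `|g x t| <= 1 + (Num.sqrt x)^-1) -> locally_integrable2 g.
Proof.
move=> mg gw K /compact_box[mK [B B0 KB]] _.
pose gK : R * R -> R := (fun z => g z.1 z.2) \_ K.
suff : (@lebesgue_measure R \x @lebesgue_measure R)%E.-integrable setT
    (EFin \o gK).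
  rewrite /gK -restrict_EFin => igK.
  exact: ((@integrable_mkcond _ _ _
    (@lebesgue_measure R \x @lebesgue_measure R)%E K _ mK).2 igK).
rewrite /gK; apply: (@integrable_prod_weight _ B 1) => //.
- by apply: (measurable_restrictT _ mK).1; exact: measurable_funTS.
- move=> x t xt; rewrite patchE; case: ifPn => // /set_mem/KB[/= xB tB].
  by case: xt; rewrite ltNge ?xB ?tB.
- move=> x t _ _; rewrite patchE mul1r; case: ifP => _; first exact: gw.
  by rewrite normr0 addr_ge0// invr_ge0 sqrtr_ge0.
Qed.

Lemma locally_integrable_usol (R : realType) : locally_integrable2 (@usol R).
Proof.
apply: locally_integrable2_weight; first exact: measurable_usol.
by move=> x t; rewrite (le_trans (usol_le _ _))// lerDr.
Qed.

Lemma locally_integrable_flux_usol (R : realType) :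
  locally_integrable2 (fun x t : R => flux x (usol x t)).
Proof.
apply: locally_integrable2_weight.
  apply: measurable_funM => //; apply: measurable_funX.
  exact: measurable_usol.
move=> x t; rewrite flux_usol; case: ifP => _; rewrite ?normr1 ?normr0.
  by rewrite lerDl invr_ge0 sqrtr_ge0.
by rewrite addr_ge0// invr_ge0 sqrtr_ge0.
Qed.

Lemma usol0_le1 (R : realType) (x : R) : `|usol x 0| <= 1.
Proof.
rewrite /usol; case: ifPn => [gx|]; last by rewrite normr0.
rewrite mulN1r normrN ger0_norm ?invr_ge0 ?sqrtr_ge0//.
have x1 : 1 < x.
  by move: gx; rewrite /gamma ler0n sub0r sqrrN expr2 -natrM divff ?pnatr_eq0.
by rewrite invf_le1 ?sqrtr_gt0 ?(lt_trans ltr01)// -sqrtr1 ler_wsqrtr// ltW.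
Qed.

Lemma measurable_usol0 (R : realType) :
  measurable_fun setT (fun x : R => usol x 0).
Proof.
apply: measurable_fun_ifT => //; first exact: measurable_fun_ltr.
by apply: measurable_funM => //; exact: measurable_invsqrt.
Qed.

Lemma usol0_Lfun (R : realType) :
  (fun x : R => usol x 0) \in Lfun (@lebesgue_measure R) +oo%E.
Proof.
apply/andP; split; rewrite inE/=; first exact: measurable_usol0.
rewrite /finite_norm unlock /Lnorm; case: ifP => // _.
apply: (@le_lt_trans _ _ 1%:E); last exact: ltry.
by apply: ess_sup_ler => x; rewrite lee_fin usol0_le1.
Qed.

Lemma usol_unbounded (R : realType) (t : R) : 2 <= t ->
  Lnorm (@lebesgue_measure R) +oo%E (fun x => (usol x t)%:E) = +oo%E.
Proof.
move=> t2; rewrite unlock /Lnorm.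
have muT : (0 < @lebesgue_measure R [set: R])%E.
  by rewrite -set_itvNyy lebesgue_measure_itv/= lt0y.
case: ifPn => [_|/negP/(_ muT)//].
have gt : gamma t = 0.
  rewrite /gamma; case: ifPn => // t2'.
  have -> : t = 2 by apply/le_anti/andP.
  by rewrite subrr expr0n mul0r.
apply: contrapT => /eqP; rewrite -ltey => sup_lty.
have [M M0 supM] : exists2 M : R, 0 < M &
    (ess_sup lebesgue_measure (abse \o (fun x => (usol x t)%:E)) <= M%:E)%E.
  move: sup_lty; case: (ess_sup _ _) => [r _||] //; last first.
    by exists 1; rewrite ?leNye.
  exists (`|r| + 1); rewrite ?ltr_pwDr//.
  by rewrite lee_fin (le_trans (ler_norm _))// lerDl.
have /ess_supP[N [mN N0 uN]] := supM.
(* On the interval from [0] to [(M + 1) ^- 2], [1 / sqrt x] exceeds [M]. *)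
pose c := (M + 1) ^- 2.
have c0 : 0 < c by rewrite invr_gt0 exprn_gt0// addr_gt0.
have cN : `]0, c[ `<=` N.
  move=> x; rewrite /= in_itv/= => /andP[x0 xc]; apply: uN => /=.
  rewrite /usol gt x0 mulN1r normrN ger0_norm ?invr_ge0 ?sqrtr_ge0// lee_fin.
  apply/negP; rewrite -ltNge.
  rewrite invf_pgt ?posrE ?sqrtr_gt0// -ltr_sqr ?nnegrE ?sqrtr_ge0 ?invr_ge0//;
    last exact: ltW.
  rewrite sqr_sqrtr ?ltW// exprVn (lt_le_trans xc)// /c.
  rewrite lef_pV2 ?posrE ?exprn_gt0 ?addr_gt0//.
  by rewrite ler_sqr ?lerDl// nnegrE ?addr_ge0// ltW.
have : (lebesgue_measure (`]0%R, c[%classic : set R) <= lebesgue_measure N)%E.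
  by apply: le_measure => //; rewrite inE//; exact: measurable_itv.
by rewrite N0 lebesgue_measure_itv/= lte_fin c0 oppr0 adde0 lee_fin leNgt c0.
Qed.

(** * Test functions *)

(** [phi] is continuously differentiable, vanishes with its first derivatives
    outside the open square of half-side [B], and is bounded by [M] together
    with them.  Apart from its sign, nothing more is used of a test function. *)
Record C1_box (R : realType) (phi : R -> R -> R) (B M : R) : Prop := {
  box_continuous : continuous (fun z : R * R => phi z.1 z.2);
  box_continuous_dx : continuous (fun z : R * R => dx phi z.1 z.2);
  box_continuous_dt : continuous (fun z : R * R => dt phi z.1 z.2);
  box_derivable_x : forall x t, derivable (phi ^~ t) x 1;
  box_derivable_t : forall x t, derivable (phi x) t 1;
  box_out : forall x t, B <= `|x| \/ B <= `|t| ->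
    [/\ phi x t = 0, dx phi x t = 0 & dt phi x t = 0];
  box_le : forall x t,
    [/\ `|phi x t| <= M, `|dx phi x t| <= M & `|dt phi x t| <= M] }.

Lemma bounded_of_support (R : realType) (f : R -> R -> R) (B : R) :
  continuous (fun z : R * R => f z.1 z.2) ->
  (forall x t, B <= `|x| \/ B <= `|t| -> f x t = 0) ->
  exists2 M, 0 <= M & forall x t, `|f x t| <= M.
Proof.
move=> cf f0.
pose K : set (R * R) := `[- B, B] `*` `[- B, B].
have cK : compact K by apply: compact_setX; exact: segment_compact.
have cfK : compact ((fun z : R * R => f z.1 z.2) @` K).
  by apply: continuous_compact => //; exact: continuous_subspaceT.
have [M [_ MK]] := compact_bounded cfK.
exists (Num.max M 0 + 1); first by rewrite addr_ge0// le_max lexx orbT.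
move=> x t; case: (leP B `|x|) => xB.
  by rewrite f0 ?normr0; [rewrite addr_ge0// le_max lexx orbT|left].
case: (leP B `|t|) => tB.
  by rewrite f0 ?normr0; [rewrite addr_ge0// le_max lexx orbT|right].
apply: MK; first by rewrite ltr_pwDr// le_max lexx.
exists (x, t) => //; split; rewrite /= in_itv/= -ler_norml ltW//.
Qed.

Lemma derive1_near0 (R : realType) (f : R -> R) (x : R) :
  (\forall y \near x, f y = 0) -> derive1 f x = 0.
Proof.
move=> f0; rewrite derive1E (@near_eq_derive _ _ _ f (cst 0)) ?derive_cst//.
Qed.

Lemma test_function_C1_box (R : realType) (phi : R -> R -> R) (B0 : R) :
  test_function phi ->
  exists B, exists M, [/\ B0 <= B, 0 < B, 0 <= M & C1_box phi B M].
Proof.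
move=> [/(_ 1%N)/= [cphi [dphix dphit [cdx _] [cdt _]]] cK _].
have [_ [B B_gt0 KB]] := compact_box cK.
have out0 x t : B < `|x| \/ B < `|t| -> phi x t = 0.
  move=> xt; apply: contrapT => /eqP phi0.
  have : closure [set z : R * R | phi z.1 z.2 != 0] (x, t).
    exact: subset_closure.
  by move=> /KB[/= xB tB]; case: xt; rewrite ltNge ?xB ?tB.
have near_out (y : R) : B < `|y| -> \forall z \near y, B < `|z|.
  move=> By.
  have oB : open ((fun z : R => `|z|) @^-1` [set z | B < z]).
    by apply: open_comp; [move=> z _; exact: norm_continuous|exact: open_gt].
  exact: open_nbhs_nbhs.
(* Beyond [B + 1], [phi] vanishes on a neighbourhood, hence so do its
   derivatives. *)
pose C := Num.max (B + 1) B0.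
have BC : B < C by rewrite /C lt_max ltrDl ltr01.
have out x t : C <= `|x| \/ C <= `|t| ->
    [/\ phi x t = 0, dx phi x t = 0 & dt phi x t = 0].
  move=> xt.
  have xt' : B < `|x| \/ B < `|t|.
    by case: xt => h; [left|right]; exact: lt_le_trans h.
  split; first exact: out0.
  - apply: derive1_near0; case: xt' => [/near_out|] h; last first.
      by apply: (@nearW _ (nbhs x)) => y; apply: out0; right.
    by apply: filterS h => y h; apply: out0; left.
  - apply: derive1_near0; case: xt' => [|/near_out] h.
      by apply: (@nearW _ (nbhs t)) => y; apply: out0; left.
    by apply: filterS h => y h; apply: out0; right.
have [M1 M10 HM1] : exists2 M, 0 <= M & forall x t, `|phi x t| <= M.
  by apply: (@bounded_of_support _ _ C cphi) => x t /out[].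
have [M2 M20 HM2] : exists2 M, 0 <= M & forall x t, `|dx phi x t| <= M.
  by apply: (@bounded_of_support _ _ C cdx) => x t /out[].
have [M3 M30 HM3] : exists2 M, 0 <= M & forall x t, `|dt phi x t| <= M.
  by apply: (@bounded_of_support _ _ C cdt) => x t /out[].
exists C, (M1 + M2 + M3); split.
- by rewrite le_max lexx orbT.
- exact: lt_trans BC.
- by rewrite !addr_ge0.
- apply: (Build_C1_box cphi cdx cdt dphix dphit out) => x t; split.
  + by rewrite (le_trans (HM1 _ _))// -addrA lerDl addr_ge0.
  + by rewrite (le_trans (HM2 _ _))// addrAC lerDr addr_ge0.
  + by rewrite (le_trans (HM3 _ _))// lerDr addr_ge0.
Qed.

Lemma continuous_slice_t (R : realType) (f : R -> R -> R) (x : R) :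
  continuous (fun z : R * R => f z.1 z.2) -> continuous (f x).
Proof.
move=> cf t; apply: (@continuous_comp _ _ _ (fun t => (x, t))
  (fun z : R * R => f z.1 z.2)); last exact: cf.
exact: (cvg_pair (cvg_cst x) cvg_id).
Qed.

Lemma continuous_slice_x (R : realType) (f : R -> R -> R) (t : R) :
  continuous (fun z : R * R => f z.1 z.2) -> continuous (f ^~ t).
Proof.
move=> cf x; apply: (@continuous_comp _ _ _ (fun x => (x, t))
  (fun z : R * R => f z.1 z.2)); last exact: cf.
exact: (cvg_pair cvg_id (cvg_cst t)).
Qed.

(** On each side of the discontinuities the integrands are of the form
    [((p + q x) phi)'], with constants [p] and [q]. *)
Lemma integral_affine_mul (R : realType) (f phi : R -> R) (p q a b : R) :
  a <= b -> measurable_fun setT f ->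
  (forall x, derivable phi x 1) -> continuous (derive1 phi) ->
  (forall x, a < x -> x < b ->
    f x = (p + q * x) * derive1 phi x + q * phi x) ->
  (\int[lebesgue_measure]_(x in `[a, b]) (f x)%:E =
   ((p + q * b) * phi b - (p + q * a) * phi a)%:E)%E.
Proof.
move=> ab mf dphi cphi' fE.
pose F x := (p + q * x) * phi x.
have cphi : continuous phi.
  by move=> x; apply: differentiable_continuous; exact/derivable1_diffP.
have dF (x : R) : is_derive x 1 F ((p + q * x) * derive1 phi x + q * phi x).
  have dphix : is_derive x 1 phi (derive1 phi x).
    by rewrite derive1E; apply: DeriveDef.
  apply: is_derive_eq.
  rewrite /GRing.scale/=; ring.
have F'E : derive1 F = fun x => (p + q * x) * derive1 phi x + q * phi x.
  by apply/funext => x; rewrite derive1E; exact: derive_val.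
rewrite (@integral_antiderivative _ f F a b ab mf).
- by [].
- by move=> x; case: (dF x).
- rewrite F'E => x.
  apply: cvgD; apply: cvgM; [|exact: cphi'|exact: cvg_cst|exact: cphi].
  by apply: cvgD; [exact: cvg_cst|apply: cvgM; [exact: cvg_cst|exact: cvg_id]].
- by move=> x; rewrite in_itv/= => /andP[ax xb]; rewrite F'E fE.
Qed.

(** * Integration in time *)

(** The time at which the curve [x = gamma t] passes through the abscissa [x],
    for [0 < x <= 1].  For [x > 1] it is [0].  For [x <= 0] it is [2], as
    [Num.sqrt x = 0]; this value is harmless since [u(x, .)] is constant. *)
Definition hit (R : realType) (x : R) : R := Num.max 0 (2 - 2 * Num.sqrt x).

Lemma gamma_sqr (R : realType) (t : R) : t <= 2 -> gamma t = ((2 - t) / 2) ^+ 2.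
Proof. by move=> t2; rewrite /gamma t2; field. Qed.

Lemma gamma_eq0 (R : realType) (t : R) : 2 <= t -> gamma t = 0.
Proof.
rewrite /gamma le_eqVlt => /predU1P[<-|t2]; last by rewrite leNgt t2.
by rewrite lexx subrr expr0n mul0r.
Qed.

Lemma gamma_le1 (R : realType) (t : R) : 0 <= t -> gamma t <= 1.
Proof.
move=> t0; case: (leP t 2) => t2; last by rewrite gamma_eq0 ?ler01// ltW.
by rewrite gamma_sqr// expr_le1//; lra.
Qed.

Lemma usol_lt_hit (R : realType) (x t : R) : 0 <= t -> t < hit x ->
  usol x t = 0.
Proof.
move=> t0; rewrite /hit lt_max [t < 0]ltNge t0/= => tT.
rewrite /usol ifF//; apply/negbTE; rewrite -leNgt.
case: (leP x 0) => x0; first exact: le_trans (gamma_ge0 t).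
have s0 := sqrtr_ge0 x.
rewrite gamma_sqr; last by lra.
by rewrite -[leLHS](sqr_sqrtr (ltW x0)) ler_sqr ?nnegrE//; lra.
Qed.

(** For [x <= 0] both sides are [0]. *)
Lemma usol_gt_hit (R : realType) (x t : R) : hit x < t ->
  usol x t = - (Num.sqrt x)^-1.
Proof.
rewrite /hit gt_max => /andP[t0 tT].
rewrite /usol mulN1r; case: ifPn => //; rewrite -leNgt => xg.
case: (leP x 0) => x0; first by rewrite ler0_sqrtr// invr0 oppr0.
exfalso; move: xg; apply/negP; rewrite -ltNge.
have s0 : 0 < Num.sqrt x by rewrite sqrtr_gt0.
case: (leP t 2) => t2; last by rewrite gamma_eq0 // ltW.
by rewrite gamma_sqr// -[ltRHS](sqr_sqrtr (ltW x0)) ltr_sqr ?nnegrE; lra.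
Qed.

(** The term of the entropy inequality that contains the derivative in time,
    extended by [0] to negative times. *)
Definition dt_part (R : realType) (k : R) (phi : R -> R -> R) (z : R * R) : R :=
  if 0 <= z.2 then `|usol z.1 z.2 - k| * dt phi z.1 z.2 else 0.

Lemma measurable_half_plane (R : realType) :
  measurable_fun setT (fun z : R * R => 0 <= z.2).
Proof. exact: measurable_fun_ler. Qed.

Lemma measurable_dt_part (R : realType) (k : R) (phi : R -> R -> R) (B M : R) :
  C1_box phi B M -> measurable_fun setT (dt_part k phi).
Proof.
move=> C; apply: measurable_fun_ifT => //; first exact: measurable_half_plane.
apply: measurable_funM; last first.
  by apply: continuous_measurable_prod; exact: (box_continuous_dt C).
apply: measurableT_comp => //; apply: measurable_funB => //.
exact: measurable_usol.
Qed.

Lemma integral_itv_support (R : realType) (f : R -> R) (a b : R) :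
  measurable_fun setT f ->
  (forall t, t < a \/ b < t -> f t = 0) ->
  (\int[lebesgue_measure]_t (f t)%:E =
   \int[lebesgue_measure]_(t in `[a, b]) (f t)%:E)%E.
Proof.
move=> mf f0; rewrite [RHS]integral_mkcond; apply: eq_integral => t _.
rewrite patchE mem_setE in_itv/=; case: ifPn => //.
by rewrite negb_and -!ltNge => /orP tab; rewrite f0.
Qed.

Lemma integral_dt_part (R : realType) (k : R) (phi : R -> R -> R) (B M x : R) :
  2 <= B -> C1_box phi B M ->
  (\int[lebesgue_measure]_t (dt_part k phi (x, t))%:E =
   (`|k| * (phi x (hit x) - phi x 0)
    - `|- (Num.sqrt x)^-1 - k| * phi x (hit x))%:E)%E.
Proof.
move=> B2 C.
have mf : measurable_fun setT (fun t => dt_part k phi (x, t)).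
  exact: measurable_fun_pair2 (measurable_dt_part k C).
have T0 : 0 <= hit x by rewrite /hit le_max lexx.
have TB : hit x <= B.
  by rewrite /hit ge_max; have := sqrtr_ge0 x; lra.
have B0 : 0 <= B by lra.
have cdt : continuous (derive1 (phi x)).
  exact: (@continuous_slice_t _ (dt phi) x (box_continuous_dt C)).
rewrite (@integral_itv_support _ _ 0 B)//; last first.
  move=> t tB; rewrite /dt_part/=; case: ifPn => // t0.
  have [_ _ ->] : [/\ phi x t = 0, dx phi x t = 0 & dt phi x t = 0].
    apply: (box_out C); right.
    by rewrite ger0_norm//; case: tB => [|/ltW//]; rewrite ltNge t0.
  by rewrite mulr0.
rewrite (itv_split T0 TB)//.
have dphi t : derivable (phi x) t 1 by exact: (box_derivable_t C).
have piece p a b : a <= b ->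
    (forall t, a < t -> t < b -> dt_part k phi (x, t) = p * dt phi x t) ->
    (\int[lebesgue_measure]_(t in `[a, b]) (dt_part k phi (x, t))%:E =
      (p * (phi x b - phi x a))%:E)%E.
  move=> ab pE; rewrite (integral_affine_mul (p := p) (q := 0) ab mf
    dphi cdt); first by congr EFin; ring.
  by move=> t ta tb; rewrite pE// /dt; ring.
rewrite (piece `|k|) //; last first.
  move=> t t0 tT; rewrite /dt_part/= ltW// usol_lt_hit// ?ltW//.
  by rewrite sub0r normrN.
rewrite (piece `|- (Num.sqrt x)^-1 - k|) //; last first.
  by move=> t tT tB; rewrite /dt_part/= (le_trans T0 (ltW tT)) usol_gt_hit.
have [-> _ _] : [/\ phi x B = 0, dx phi x B = 0 & dt phi x B = 0].
  by apply: (box_out C); right; exact: ler_norm.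
by rewrite -EFinD; congr EFin; ring.
Qed.

(** * Integration in space *)

(** The term of the entropy inequality that contains the derivative in space,
    extended by [0] to negative times. *)
Definition flux_part (R : realType) (k : R) (phi : R -> R -> R) (z : R * R) :
    R :=
  if 0 <= z.2 then Num.sg (usol z.1 z.2 - k) *
    (flux z.1 (usol z.1 z.2) - flux z.1 k) * dx phi z.1 z.2 else 0.

(** The source term of the entropy inequality, extended by [0] to negative
    times. *)
Definition source_part (R : realType) (k : R) (phi : R -> R -> R) (z : R * R) :
    R :=
  if 0 <= z.2 then Num.sg (usol z.1 z.2 - k) * derive1 (flux ^~ k) z.1
    * phi z.1 z.2 else 0.

Lemma derive1_flux (R : realType) (k x : R) : derive1 (flux ^~ k) x = k ^+ 2.
Proof.
rewrite derive1E /flux.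
have H : is_derive x 1 (fun y : R => y * k ^+ 2) (k ^+ 2).
  by apply: is_derive_eq; rewrite /GRing.scale/=; ring.
by rewrite (derive_val (is_derive := H)).
Qed.

Lemma measurable_sgr (R : realType) : measurable_fun setT (@Num.sg R).
Proof.
have -> : @Num.sg R = fun x => if 0 < x then 1 else if x < 0 then -1 else 0.
  by apply/funext => x; case: sgrP.
apply: measurable_fun_ifT => //; first exact: measurable_fun_ltr.
by apply: measurable_fun_ifT => //; exact: measurable_fun_ltr.
Qed.

Lemma measurable_sgr_usol (R : realType) (k : R) :
  measurable_fun setT (fun z : R * R => Num.sg (usol z.1 z.2 - k)).
Proof.
apply: (measurableT_comp (@measurable_sgr R)); apply: measurable_funB => //.
exact: measurable_usol.
Qed.

Lemma measurable_flux_part (R : realType) (k : R) (phi : R -> R -> R)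
  (B M : R) : C1_box phi B M -> measurable_fun setT (flux_part k phi).
Proof.
move=> C; apply: measurable_fun_ifT => //; first exact: measurable_half_plane.
apply: measurable_funM; last first.
  by apply: continuous_measurable_prod; exact: (box_continuous_dx C).
apply: measurable_funM; first exact: measurable_sgr_usol.
apply: measurable_funB; apply: measurable_funM => //.
by apply: measurable_funX; exact: measurable_usol.
Qed.

Lemma measurable_source_part (R : realType) (k : R) (phi : R -> R -> R)
  (B M : R) : C1_box phi B M -> measurable_fun setT (source_part k phi).
Proof.
move=> C; apply: measurable_fun_ifT => //; first exact: measurable_half_plane.
apply: measurable_funM; last first.
  by apply: continuous_measurable_prod; exact: (box_continuous C).
apply: measurable_funM; first exact: measurable_sgr_usol.
have -> : (fun z : R * R => derive1 (flux ^~ k) z.1) = cst (k ^+ 2).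
  by apply/funext => z; exact: derive1_flux.
exact: measurable_cst.
Qed.

(** The square root of [gamma t], for all [t]. *)
Definition shock_root (R : realType) (t : R) : R := Num.max 0 ((2 - t) / 2).

Lemma shock_root_ge0 (R : realType) (t : R) : 0 <= shock_root t.
Proof. by rewrite /shock_root le_max lexx. Qed.

Lemma sqr_shock_root (R : realType) (t : R) : shock_root t ^+ 2 = gamma t.
Proof.
rewrite /shock_root; case: (leP t 2) => t2.
  by rewrite gamma_sqr// max_r//; lra.
by rewrite gamma_eq0 ?ltW// max_l ?expr0n//; lra.
Qed.

(** With [a = k * sqrt (gamma t)], the difference between the left and the right
    limits at [x = gamma t] of the entropy flux
    [sgn (u - k) (f(x, u) - f(x, k))], namely
    [sgn a * a ^ 2 + sgn (1 + a) * (1 - a ^ 2)]. *)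
Definition jump (R : realType) (a : R) : R := a * `|a| + `|1 + a| * (1 - a).

(** The abscissa [1 / k ^ 2] at which [u = k], for [k < 0], is a further break
    point when it lies to the right of the curve; the entropy flux is continuous
    there, so that it does not contribute. *)
Lemma integral_space (R : realType) (k : R) (phi : R -> R -> R) (B M t : R) :
  1 <= B -> (k ^+ 2)^-1 <= B -> C1_box phi B M -> 0 <= t ->
  (\int[lebesgue_measure]_x
     (flux_part k phi (x, t) - source_part k phi (x, t))%:E =
   (jump (k * shock_root t) * phi (gamma t) t)%:E)%E.
Proof.
move=> B1 kB C t0.
set F := fun x => flux_part k phi (x, t) - source_part k phi (x, t).
have mF : measurable_fun setT F.
  apply: measurable_funB.
  - exact: measurable_fun_pair1 (measurable_flux_part k C).
  - exact: measurable_fun_pair1 (measurable_source_part k C).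
have g0 := gamma_ge0 t.
have g1 := gamma_le1 t0.
have out x : `|x| >= B -> phi x t = 0 /\ dx phi x t = 0.
  move=> xB.
  by have [-> -> _] : [/\ phi x t = 0, dx phi x t = 0 & dt phi x t = 0]
    by apply: (box_out C); left.
have [phiB _] : phi B t = 0 /\ dx phi B t = 0 by apply: out; exact: ler_norm.
have [phiNB _] : phi (- B) t = 0 /\ dx phi (- B) t = 0.
  by apply: out; rewrite normrN; exact: ler_norm.
have dphi x : derivable (phi ^~ t) x 1 by exact: (box_derivable_x C).
have cphi : continuous (derive1 (phi ^~ t)).
  exact: (@continuous_slice_x _ (dx phi) t (box_continuous_dx C)).
have FE x : F x = Num.sg (usol x t - k) *
    ((flux x (usol x t) - x * k ^+ 2) * dx phi x t - k ^+ 2 * phi x t).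
  by rewrite /F /flux_part /source_part /= t0 derive1_flux {2}/flux; ring.
have FL x : x < gamma t ->
    F x = (0 + Num.sg k * k ^+ 2 * x) * dx phi x t
          + Num.sg k * k ^+ 2 * phi x t.
  move=> xg; rewrite FE flux_usol ltNge (ltW xg)/= /usol ltNge (ltW xg)/=.
  by rewrite sub0r sgrN; ring.
have FR (e : R) x : gamma t < x -> Num.sg (- (Num.sqrt x)^-1 - k) = e ->
    F x = (e + - (e * k ^+ 2) * x) * dx phi x t + - (e * k ^+ 2) * phi x t.
  move=> xg se; rewrite FE flux_usol xg /usol xg mulN1r se; ring.
have Ng : - B <= gamma t by lra.
have gB : gamma t <= B by lra.
rewrite (@integral_itv_support _ F (- B) B)//; last first.
  move=> x xB; have [xp xd] : phi x t = 0 /\ dx phi x t = 0.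
    apply: out; rewrite ler_normr; apply/orP.
    by case: xB => h; [right; rewrite lerNr|left]; exact: ltW.
  by rewrite FE xp xd; ring.
have piece p q a b : a <= b ->
    (forall x, a < x -> x < b ->
      F x = (p + q * x) * dx phi x t + q * phi x t) ->
    (\int[lebesgue_measure]_(x in `[a, b]) (F x)%:E =
      ((p + q * b) * phi b t - (p + q * a) * phi a t)%:E)%E.
  by move=> ab FE'; exact: (integral_affine_mul ab mF dphi cphi FE').
rewrite (itv_split Ng gB mF).
rewrite (piece 0 (Num.sg k * k ^+ 2)) //; last first.
  by move=> x _ /FL.
rewrite phiNB.
have s0 := shock_root_ge0 t.
rewrite -sqr_shock_root in g0 g1 Ng gB FL FR *.
set s := shock_root t in s0 g0 g1 Ng gB FL FR *.
(* For [k >= 0], [u < k] holds on the whole right side. *)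
have [k0|k0] := leP 0 k.
  rewrite (piece (-1) (k ^+ 2)) //; last first.
    move=> x gx _; rewrite (FR (-1) _ gx); first by ring.
    apply: ltr0_sg; have : 0 < (Num.sqrt x)^-1.
      by rewrite invr_gt0 sqrtr_gt0 (le_lt_trans _ gx).
    lra.
  rewrite phiB -EFinD; congr EFin.
  rewrite /jump (ger0_norm (mulr_ge0 k0 s0)) ger0_norm ?addr_ge0 ?mulr_ge0//.
  have -> : Num.sg k * k ^+ 2 = k ^+ 2.
    by move: k0; rewrite le_eqVlt => /predU1P[<-|/gtr0_sg ->]; ring.
  ring.
have k2 : 0 < k ^+ 2 by rewrite exprn_even_gt0//= lt_eqF.
have invk : Num.sqrt (k ^+ 2)^-1 = (- k)^-1.
  by rewrite sqrtrV ?ltW// sqrtr_sqr ltr0_norm.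
have sgR x : (k ^+ 2)^-1 < x -> Num.sg (- (Num.sqrt x)^-1 - k) = 1.
  move=> kx; apply: gtr0_sg.
  have : (Num.sqrt x)^-1 < - k.
    rewrite invf_plt ?posrE ?oppr_gt0 ?sqrtr_gt0//.
      by rewrite -invk ltr_sqrt// (lt_trans _ kx)// invr_gt0.
    by rewrite (lt_trans _ kx)// invr_gt0.
  lra.
have sgL x : 0 < x -> x < (k ^+ 2)^-1 -> Num.sg (- (Num.sqrt x)^-1 - k) = -1.
  move=> x0 kx; apply: ltr0_sg.
  have : - k < (Num.sqrt x)^-1.
    rewrite -[- k]invrK -invk ltf_pV2 ?posrE ?sqrtr_gt0 ?invr_gt0//.
    by rewrite ltr_sqrt// invr_gt0.
  lra.
have sgk : Num.sg k = -1 by exact: ltr0_sg.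
have ks0 : k * s <= 0 by rewrite mulr_le0_ge0// ltW.
(* Either [1 / k ^ 2] lies on the right side of the curve, or [u > k] there. *)
have [kg|kg] := leP (s ^+ 2) (k ^+ 2)^-1; last first.
  rewrite (piece 1 (- k ^+ 2)) //; last first.
    move=> x gx _; rewrite (FR 1 _ gx); first by ring.
    by apply: sgR; exact: lt_trans gx.
  rewrite phiB -EFinD sgk; congr EFin.
  have ks1 : k * s <= -1.
    have : 1 <= (k * s) ^+ 2.
      by rewrite exprMn mulrC -ler_pdivrMr// mul1r ltW.
    by nra.
  rewrite /jump (ler0_norm ks0) ler0_norm; last by lra.
  ring.
rewrite (itv_split kg kB mF).
rewrite (piece (-1) (k ^+ 2)) //; last first.
  move=> x gx kx; rewrite (FR (-1) _ gx); first by ring.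
  by apply: sgL => //; exact: le_lt_trans gx.
rewrite (piece 1 (- k ^+ 2)) //; last first.
  move=> x kx _; rewrite (FR 1 x (le_lt_trans kg kx)); first by ring.
  exact: sgR.
rewrite phiB -!EFinD sgk; congr EFin.
have ks1 : - 1 <= k * s.
  have : (k * s) ^+ 2 <= 1.
    by rewrite exprMn mulrC -ler_pdivlMr// mul1r.
  by nra.
rewrite /jump (ler0_norm ks0) ger0_norm; last by lra.
by field; rewrite lt_eqF.
Qed.

(** * Change of variables along the curve *)

(** The substitution [x = ((2 - t) / 2) ^ 2], from the interval from [0] to
    [2] onto the interval from [0] to [1].  The function [g] may be unbounded at
    [0], so the fundamental theorem of calculus is applied to a primitive of [g]
    composed with the substitution. *)
Lemma substitution_parabola (R : realType) (g h : R -> R) :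
  (@lebesgue_measure R).-integrable `[0, 1] (EFin \o g) ->
  {in `]0, 1[, continuous g} -> continuous h ->
  (forall t, 0 < t -> t < 2 ->
    h t = g (((2 - t) / 2) ^+ 2) * ((2 - t) / 2)) ->
  \int[lebesgue_measure]_(x in `[0, 1]) g x =
  \int[lebesgue_measure]_(t in `[0, 2]) h t.
Proof.
move=> ig cg ch hE.
pose c (t : R) := ((2 - t) / 2) ^+ 2.
pose G y := \int[lebesgue_measure]_(x in `[0, y]) g x.
have c0 : c 0 = 1 by rewrite /c; field.
have c2 : c 2 = 0 by rewrite /c; field.
have dc (t : R) : is_derive t 1 c (- ((2 - t) / 2)).
  by apply: is_derive_eq; rewrite /GRing.scale/=; field.
have decr_c : {in `[0, 2] &, {homo c : x y /~ x < y}}.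
  move=> x y; rewrite !in_itv/= => /andP[x0 x2] /andP[y0 y2] xy.
  by rewrite /c ltr_sqr ?nnegrE; lra.
have cc : continuous c.
  move=> t; apply: differentiable_continuous; apply/derivable1_diffP.
  by case: (dc t).
have /(continuous_within_itvP _ ltr01)[_ G0 G1] :
    {within `[0, 1], continuous G}.
  exact: parameterized_integral_continuous.
have dG (t : R) : 0 < t -> t < 2 ->
    is_derive t 1 (G \o c) (g (c t) * - ((2 - t) / 2)).
  move=> t0 t2; have ct0 : 0 < c t by rewrite /c exprn_gt0//; lra.
  have ct1 : c t < 1 by rewrite /c expr_lt1//; lra.
  have ctin : c t \in `]0, 1[ by rewrite in_itv/= ct0.
  have [dGt G't] := continuous_FTC1_closed ct1 ig ct0 (cg _ ctin).
  apply: is_derive1_comp; rewrite -G't derive1E; exact: DeriveDef.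
have lt02 : (0 : R) < 2 by [].
have ftc := @continuous_FTC2 _ (fun t => - h t) (G \o c) 0 2 lt02.
have {ftc} : (\int[lebesgue_measure]_(t in `[0%R, 2%R]) (- h t)%:E =
    ((G \o c) 2%R)%:E - ((G \o c) 0%R)%:E)%E.
  apply: ftc.
  - by apply: continuous_subspaceT => t; apply: cvgN; exact: ch.
  - split.
    + by move=> t; rewrite in_itv/= => /andP[t0 t2]; case: (dG t t0 t2).
    + apply: (@decreasing_cvg_at_right_comp _ c G 0 (BRight 2)) => //.
      * by apply: cvg_at_right_filter; exact: cc.
      * by rewrite /= c0.
    + apply: (@decreasing_cvg_at_left_comp _ c G (BLeft 0) 2) => //.
      * by apply: cvg_at_left_filter; exact: cc.
      * by rewrite /= c2.
  - move=> t; rewrite in_itv/= => /andP[t0 t2].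
    have dGt := dG t t0 t2.
    by rewrite derive1E (derive_val (is_derive := dGt)) hE// mulrN.
rewrite /= c2 c0 {1}/G set_itv1 Rintegral_set1 add0e.
have ih : (@lebesgue_measure R).-integrable `[0, 2]
    (EFin \o (fun t => - h t)).
  apply: continuous_compact_integrable; first exact: segment_compact.
  by apply: continuous_subspaceT => t; apply: cvgN; exact: ch.
move=> hG.
have : (\int[lebesgue_measure]_(t in `[0%R, 2%R]) (h t)%:E = (G 1%R)%:E)%E.
  rewrite -[G 1]opprK EFinN -hG -integralN; last exact: integrable_add_def ih.
  by apply: eq_integral => t _; rewrite /= opprK.
by rewrite /Rintegral => ->.
Qed.

(** The contribution of the jump of [u(x, .)] at the time [hit x] to the
    integral in time of [|u - k| phi_t]. *)
Definition trace (R : realType) (k : R) (phi : R -> R -> R) (x : R) : R :=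
  if (0 < x) && (x <= 1) then
    (`|k| - `|- (Num.sqrt x)^-1 - k|) * phi x (hit x) else 0.

Lemma integral_trace (R : realType) (k : R) (phi : R -> R -> R) (B M : R) :
  C1_box phi B M ->
  (@lebesgue_measure R).-integrable setT (EFin \o trace k phi) ->
  let h t :=
    (`|k * shock_root t| - `|1 + k * shock_root t|) * phi (gamma t) t in
  (@lebesgue_measure R).-integrable `[0, 2] (EFin \o h) /\
  \int[lebesgue_measure]_x trace k phi x =
  \int[lebesgue_measure]_(t in `[0, 2]) h t.
Proof.
move=> C itrace h0.
have croot : continuous (fun t : R => (2 - t) / 2).
  move=> t; apply: cvgM; last exact: cvg_cst.
  by apply: cvgB; [exact: cvg_cst|exact: cvg_id].
have cphi (u v : R -> R) (x : R) : {for x, continuous u} ->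
    {for x, continuous v} -> {for x, continuous (fun x => phi (u x) (v x))}.
  move=> cu cv; apply: (@continuous_comp _ _ _ (fun x => (u x, v x))
    (fun z : R * R => phi z.1 z.2)); last exact: (box_continuous C).
  exact: (cvg_pair cu cv).
have -> : \int[lebesgue_measure]_x trace k phi x =
    \int[lebesgue_measure]_(x in `[0, 1]) trace k phi x.
  rewrite [RHS]Rintegral_mkcond; apply: eq_Rintegral => x _.
  rewrite patchE mem_setE in_itv/=; case: ifPn => //.
  rewrite negb_and -!ltNge /trace => x01; rewrite ifF//; apply/negbTE.
  rewrite negb_and -!leNgt -ltNge.
  by case/orP: x01 => [/ltW|] ->; rewrite ?orbT.
pose h (t : R) := (`|k * ((2 - t) / 2)| - `|1 + k * ((2 - t) / 2)|) *
  phi (((2 - t) / 2) ^+ 2) t.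
have ch : continuous h.
  move=> t; apply: cvgM; last first.
    apply: (cphi (fun t => ((2 - t) / 2) ^+ 2) id); last exact: cvg_id.
    by apply: cvgM; exact: croot.
  apply: cvgB; apply: cvg_norm.
    by apply: cvgM; [exact: cvg_cst|exact: croot].
  apply: cvgD; first exact: cvg_cst.
  by apply: cvgM; [exact: cvg_cst|exact: croot].
have hh0 t : t \in `[0, 2]%classic -> h t = h0 t.
  rewrite inE/= in_itv/= => /andP[t0 t2].
  by rewrite /h /h0 gamma_sqr// /shock_root max_r//; lra.
split.
  apply: (@eq_integrable _ _ _ lebesgue_measure _ _ (EFin \o h)) => //.
    by move=> t t02 /=; rewrite hh0.
  apply: continuous_compact_integrable; first exact: segment_compact.
  exact: continuous_subspaceT.
rewrite (@substitution_parabola _ _ h) //.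
- by apply: eq_Rintegral => t t02; exact: hh0.
- exact: (integrableS measurableT _ _ itrace).
- move=> x; rewrite in_itv/= => /andP[x0 x1].
  pose e (y : R) :=
    (`|k| - `|- (Num.sqrt y)^-1 - k|) * phi y (2 - 2 * Num.sqrt y).
  have tE (y : R) : 0 < y -> y < 1 -> e y = trace k phi y.
    move=> y0 y1; rewrite /trace y0 ltW//= /e /hit max_r//.
    have : Num.sqrt y <= 1 by rewrite -sqrtr1 ler_sqrt// ltW.
    lra.
  suff ce : e y @[y --> x] --> e x.
    rewrite /prop_for/continuous_at -tE//; apply: cvg_trans ce.
    apply: near_eq_cvg; near=> y; rewrite tE//; near: y.
      exact: lt_nbhsr.
    exact: lt_nbhsl.
  have cs : {for x, continuous (fun y : R => Num.sqrt y)}.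
    exact: sqrt_continuous.
  apply: cvgM; last first.
    apply: (cphi id (fun y => 2 - 2 * Num.sqrt y)); first exact: cvg_id.
    by apply: cvgB; [exact: cvg_cst|apply: cvgM; [exact: cvg_cst|exact: cs]].
  apply: cvgB; first exact: cvg_cst.
  apply: cvg_norm; apply: cvgB; last exact: cvg_cst.
  apply: cvgN; apply: cvgV; last exact: cs.
  by rewrite gt_eqF// sqrtr_gt0.
- move=> t t0 t2; set s := (2 - t) / 2.
  have s0 : 0 < s by rewrite /s; lra.
  have s1 : s < 1 by rewrite /s; lra.
  have ss : Num.sqrt (s ^+ 2) = s by rewrite sqrtr_sqr gtr0_norm.
  have ht : hit (s ^+ 2) = t by rewrite /hit ss max_r /s; lra.
  rewrite /h -/s /trace exprn_gt0// expr_le1 ?(ltW s0)// (ltW s1) ss ht/=.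
  have -> : `|- s^-1 - k| = `|1 + k * s| / s.
    rewrite -[X in _ / X](gtr0_norm s0) -normf_div -normrN; congr `|_|.
    by field; rewrite gt_eqF.
  by rewrite normrM (gtr0_norm s0); field; rewrite gt_eqF.
Unshelve. all: by end_near. Qed.

(** * The entropy inequality *)

Lemma shock_root_eq0 (R : realType) (t : R) : 2 <= t -> shock_root t = 0.
Proof. by move=> t2; rewrite /shock_root max_l//; lra. Qed.

(** The entropy condition along the shock. *)
Lemma jump_trace_ge0 (R : realType) (a : R) : 0 <= `|a| - `|1 + a| + jump a.
Proof.
rewrite /jump; have [a0|a0] := leP 0 a.
  have a1 : 0 <= 1 + a by lra.
  by rewrite (ger0_norm a0) (ger0_norm a1); nra.
rewrite (ltr0_norm a0); have [a1|a1] := leP 0 (1 + a).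
  by rewrite (ger0_norm a1); nra.
by rewrite (ltr0_norm a1); nra.
Qed.

Lemma integrable_dt_part (R : realType) (k : R) (phi : R -> R -> R) (B M : R) :
  0 <= M -> C1_box phi B M ->
  (@lebesgue_measure R \x @lebesgue_measure R)%E.-integrable setT
    (EFin \o dt_part k phi).
Proof.
move=> M0 C; apply: (@integrable_prod_weight _ B ((1 + `|k|) * M)).
- by rewrite mulr_ge0// addr_ge0.
- exact: measurable_dt_part C.
- move=> x t xt; rewrite /dt_part/=; case: ifP => // _.
  have [_ _ ->] : [/\ phi x t = 0, dx phi x t = 0 & dt phi x t = 0].
    by apply: (box_out C); case: xt => /ltW; [left|right].
  by rewrite mulr0.
- move=> x t _ _; have s0 : 0 <= (Num.sqrt x)^-1 by rewrite invr_ge0 sqrtr_ge0.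
  have k0 := normr_ge0 k.
  rewrite /dt_part/=; case: ifP => _; last first.
    by rewrite normr0 !mulr_ge0// addr_ge0.
  have [_ _ dM] := box_le C x t.
  rewrite normrM normr_id mulrAC ler_pM//.
  apply: le_trans (ler_normB _ _) _.
  have := usol_le x t; nra.
Qed.

Lemma integrable_flux_part (R : realType) (k : R) (phi : R -> R -> R)
  (B M : R) : 0 <= B -> 0 <= M -> C1_box phi B M ->
  (@lebesgue_measure R \x @lebesgue_measure R)%E.-integrable setT
    (EFin \o flux_part k phi).
Proof.
move=> B0 M0 C; have k20 := sqr_ge0 k.
apply: (@integrable_prod_weight _ B ((1 + B * k ^+ 2) * M)).
- by rewrite mulr_ge0// addr_ge0// mulr_ge0.
- exact: measurable_flux_part C.
- move=> x t xt; rewrite /flux_part/=; case: ifP => // _.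
  have [_ -> _] : [/\ phi x t = 0, dx phi x t = 0 & dt phi x t = 0].
    by apply: (box_out C); case: xt => /ltW; [left|right].
  by rewrite mulr0.
- move=> x t xB _; have s0 : 0 <= (Num.sqrt x)^-1 by rewrite invr_ge0 sqrtr_ge0.
  have K0 : 0 <= (1 + B * k ^+ 2) * M by rewrite mulr_ge0// addr_ge0// mulr_ge0.
  rewrite (@le_trans _ _ ((1 + B * k ^+ 2) * M))//; last first.
    by rewrite ler_peMr ?lerDl.
  rewrite /flux_part/=; case: ifP => _; last by rewrite normr0.
  have [_ dM _] := box_le C x t.
  rewrite normrM ler_pM// normrM -[leRHS]mul1r ler_pM//.
    by rewrite normr_sg; case: (_ != 0).
  apply: le_trans (ler_normB _ _) _; apply: lerD.
    by rewrite flux_usol; case: ifP => _; rewrite ?normr1 ?normr0.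
  by rewrite /flux normrM (ger0_norm k20) ler_wpM2r.
Qed.

Lemma integrable_source_part (R : realType) (k : R) (phi : R -> R -> R)
  (B M : R) : 0 <= M -> C1_box phi B M ->
  (@lebesgue_measure R \x @lebesgue_measure R)%E.-integrable setT
    (EFin \o source_part k phi).
Proof.
move=> M0 C; have k20 := sqr_ge0 k.
apply: (@integrable_prod_weight _ B (k ^+ 2 * M)).
- by rewrite mulr_ge0.
- exact: measurable_source_part C.
- move=> x t xt; rewrite /source_part/=; case: ifP => // _.
  have [-> _ _] : [/\ phi x t = 0, dx phi x t = 0 & dt phi x t = 0].
    by apply: (box_out C); case: xt => /ltW; [left|right].
  by rewrite mulr0.
- move=> x t xB _; have s0 : 0 <= (Num.sqrt x)^-1 by rewrite invr_ge0 sqrtr_ge0.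
  rewrite (@le_trans _ _ (k ^+ 2 * M))//; last first.
    by rewrite ler_peMr ?lerDl// mulr_ge0.
  rewrite /source_part/=; case: ifP => _; last by rewrite normr0 mulr_ge0.
  have [pM _ _] := box_le C x t.
  rewrite normrM ler_pM// derive1_flux normrM -[leRHS]mul1r ler_pM//.
    by rewrite normr_sg; case: (_ != 0).
  by rewrite (ger0_norm k20).
Qed.

Lemma integrable_initial (R : realType) (k : R) (phi : R -> R -> R) (B M : R) :
  0 <= M -> C1_box phi B M ->
  (@lebesgue_measure R).-integrable setT
    (EFin \o (fun x => `|usol x 0 - k| * phi x 0)).
Proof.
move=> M0 C.
have iw := integrableZl measurableT ((1 + `|k|) * M) (integrable_weight B).
apply: (le_integrable measurableT _ _ iw).
- apply/measurable_EFinP; apply: measurable_funM.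
    apply: measurableT_comp => //; apply: measurable_funB => //.
    exact: measurable_usol0.
  apply: continuous_measurable_fun.
  exact: (@continuous_slice_x _ phi 0 (box_continuous C)).
- move=> x _ /=; rewrite lee_fin.
  have s0 : 0 <= (Num.sqrt x)^-1 by rewrite invr_ge0 sqrtr_ge0.
  rewrite /weight; case: (leP `|x| B) => xB; last first.
    have [-> _ _] : [/\ phi x 0 = 0, dx phi x 0 = 0 & dt phi x 0 = 0].
      by apply: (box_out C); left; exact: ltW.
    by rewrite !mulr0.
  have [pM _ _] := box_le C x 0.
  have k0 := normr_ge0 k.
  rewrite [leRHS]ger0_norm ?mulr_ge0 ?addr_ge0//.
  rewrite normrM normr_id mulrAC ler_pM//.
  apply: le_trans (ler_normB _ _) _.
  have := usol_le x 0; nra.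
Qed.

Lemma entropy_inequality_usol (R : realType) (k : R) (phi : R -> R -> R) :
  test_function phi ->
  \int[(@lebesgue_measure R \x @lebesgue_measure R)%E]_(z in half_plane)
    (`|usol z.1 z.2 - k| * dt phi z.1 z.2 +
     Num.sg (usol z.1 z.2 - k) * (flux z.1 (usol z.1 z.2) - flux z.1 k)
       * dx phi z.1 z.2)
  >= \int[(@lebesgue_measure R \x @lebesgue_measure R)%E]_(z in half_plane)
       (Num.sg (usol z.1 z.2 - k) * derive1 (flux ^~ k) z.1 * phi z.1 z.2)
     - \int[@lebesgue_measure R]_x (`|usol x 0 - k| * phi x 0).
Proof.
move=> tphi; have phi0 : forall x t, 0 <= t -> 0 <= phi x t by case: tphi.
have [B [M [BB B0 M0 C]]] := test_function_C1_box (2 + (k ^+ 2)^-1) tphi.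
have k20 : 0 <= (k ^+ 2)^-1 by rewrite invr_ge0 sqr_ge0.
have B2 : 2 <= B by lra.
have B1 : 1 <= B by lra.
have kB : (k ^+ 2)^-1 <= B by lra.
have id := integrable_dt_part k M0 C.
have iflux := integrable_flux_part k (ltW B0) M0 C.
have isrc := integrable_source_part k M0 C.
have ini := integrable_initial k M0 C.
have hp (z : R * R) : (z \in half_plane) = (0 <= z.2).
  by apply/idP/idP; rewrite inE.
rewrite [leRHS](_ : _ = \int[(@lebesgue_measure R \x @lebesgue_measure R)%E]_z
    (dt_part k phi z + flux_part k phi z)); last first.
  rewrite [LHS]Rintegral_mkcond; apply: eq_Rintegral => z _.
  rewrite patchE hp /dt_part /flux_part.
  by case: ifP => _; rewrite ?addr0.
rewrite [X in X - _ <= _](_ : _ =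
    \int[(@lebesgue_measure R \x @lebesgue_measure R)%E]_z source_part k phi z);
    last first.
  rewrite [LHS]Rintegral_mkcond; apply: eq_Rintegral => z _.
  by rewrite patchE hp /source_part.
rewrite lerBlDr -lerBlDl.
rewrite (RintegralD measurableT id iflux).
have [iI1 ->] := fubini_x id (fun x => integral_dt_part k x B2 C).
(* The result of the integration in [x] of the flux and source terms. *)
pose I2 t := if 0 <= t then jump (k * shock_root t) * phi (gamma t) t else 0.
have idiff : (@lebesgue_measure R \x @lebesgue_measure R)%E.-integrable setT
    (EFin \o (fun z => flux_part k phi z - source_part k phi z)).
  exact: integrableB iflux isrc.
have [iI2 E2] : (@lebesgue_measure R).-integrable setT (EFin \o I2) /\
    \int[(@lebesgue_measure R \x @lebesgue_measure R)%E]_z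
      (flux_part k phi z - source_part k phi z) =
    \int[lebesgue_measure]_t I2 t.
  apply: fubini_t => // t; rewrite /I2; case: ifPn => t0.
    exact: (integral_space B1 kB C t0).
  rewrite integral0_eq// => x _.
  by rewrite /flux_part /source_part/= (negbTE t0) subrr.
rewrite RintegralB// in E2.
pose u0 x := `|usol x 0 - k| * phi x 0.
pose I1 x := `|k| * (phi x (hit x) - phi x 0)
  - `|- (Num.sqrt x)^-1 - k| * phi x (hit x).
have traceE x : trace k phi x = I1 x + u0 x.
  rewrite /trace /I1 /u0; case: ifPn.
    move=> /andP[x0 x1]; rewrite /usol /gamma ler0n sub0r sqrrN.
    have -> : (2 ^+ 2 / 4 : R) = 1 by field.
    by rewrite ltNge x1/= sub0r normrN; ring.
  rewrite negb_and -leNgt -ltNge => /orP[x0|x1].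
    rewrite /usol ltNge (le_trans x0 (gamma_ge0 _))/= ler0_sqrtr// invr0 oppr0.
    by rewrite sub0r normrN; ring.
  have s1 : 1 < Num.sqrt x.
    by rewrite -[ltLHS]sqrtr1 ltr_sqrt// (lt_trans ltr01).
  rewrite /usol (le_lt_trans (gamma_le1 _) x1)// mulN1r.
  by rewrite /hit max_l ?subr_le0; [ring|lra].
have itr : (@lebesgue_measure R).-integrable setT (EFin \o trace k phi).
  have -> : EFin \o trace k phi = (EFin \o I1) \+ (EFin \o u0) :> (R -> \bar R).
    by apply/funext => x /=; rewrite traceE.
  exact: integrableD iI1 ini.
have [ih Eh] := integral_trace C itr.
have E1 : \int[lebesgue_measure]_x I1 x + \int[lebesgue_measure]_x u0 x =
    \int[lebesgue_measure]_x trace k phi x.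
  rewrite -RintegralD//; apply: eq_Rintegral => x _; exact/esym/traceE.
have iI202 : (@lebesgue_measure R).-integrable `[0, 2] (EFin \o I2).
  exact: integrableS iI2.
(* After the time [2] the integrand is [phi (gamma t) t >= 0]. *)
have I2_ge : \int[lebesgue_measure]_(t in `[0, 2]) I2 t <=
    \int[lebesgue_measure]_t I2 t.
  rewrite [leLHS]Rintegral_mkcond; apply: le_Rintegral => //.
    rewrite -restrict_EFin; exact: (integrable_mkcond _ _).1.
  move=> t _; rewrite patchE mem_setE in_itv/= /I2.
  case: ifP => // t02; case: ifP => // t0.
  have t2 : 2 < t by move: t02; rewrite t0/= => /negbT; rewrite -ltNge.
  rewrite (shock_root_eq0 (ltW t2)) /jump mulr0 mul0r add0r addr0 subr0.
  by rewrite normr1 !mul1r; exact: phi0.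
have sum_ge0 : 0 <= \int[lebesgue_measure]_x trace k phi x +
    \int[lebesgue_measure]_(t in `[0, 2]) I2 t.
  rewrite Eh -RintegralD//; apply: Rintegral_ge0 => t.
  rewrite /= in_itv/= => /andP[t0 t2]; rewrite /I2 t0 -mulrDl.
  by rewrite mulr_ge0 ?jump_trace_ge0// phi0.
move: E1 E2 I2_ge sum_ge0; rewrite /I1 /u0; lra.
Qed.

Theorem mainTheorem2 (R : realType) :
  [/\ entropy_solution (@flux R) (fun x => usol x 0) usol,
      exists M : R, forall x : R, `|usol x 0| <= M &
      forall t : R, 2 <= t ->
        Lnorm (@lebesgue_measure R) +oo%E (fun x => (usol x t)%:E) = +oo%E].
Proof.
split; last exact: usol_unbounded.
- split; first exact: usol0_Lfun.
  + exact: locally_integrable_usol.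
  + exact: locally_integrable_flux_usol.
  + by move=> k phi; exact: entropy_inequality_usol.
- by exists 1 => x; exact: usol0_le1.
Qed.
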